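(* Let $a^*$ be the unique number in $(0,1)$ with $\frac{2\sin^2(a^*\pi)}{(a^* )^2\pi^2}=1$. Fix $0<a<1$ and, for each $d\ge 1$, let $\rho=\frac{a\pi}{d}$, $\tau_i=\frac{(i-1/2)\pi}{d}$ for $i=1,\dots,d$, $s_i=[\cos(\tau_i+\rho),\cos(\tau_i-\rho)]$, and let $V_d\in\mathbb{R}^{d\times d}$ be the matrix with entries $$[V_d]_{i,j}=\int_{s_i}U_{j-1}(x)\,\mathrm{d}x=\frac{2}{j}\sin(j\tau_i)\sin(j\rho).$$ Then $$\lim_{d\to\infty}\kappa_2(V_d)=\begin{cases}\dfrac{a\pi}{\sin(a\pi)} & \text{if } a^*<a<1,\\[6pt] \sqrt2 & \text{if } 0<a<a^*.\end{cases}$$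
   Context: $U_{j-1}(x)=\frac{\sin(j\arccos x)}{\sin(\arccos x)}$ is the Chebyshev polynomial of the second kind of degree $j-1$. $\kappa_2(A)=\|A\|_2\|A^{-1}\|_2$ is the condition number in the spectral norm. The number $a^*$ is the threshold value separating the parameters $a$ for which $\lim_{d\to\infty}[V_d^\top V_d]_{d,d}/[V_d^\top V_d]_{1,1}=\frac{2\sin^2(a\pi)}{a^2\pi^2}$ is larger, respectively smaller, than $1$. *)

(* Defs.v *)
From HB Require Import structures.
From mathcomp Require Import all_boot all_order all_algebra.
From mathcomp Require Import all_classical all_reals all_analysis.

Set Implicit Arguments.
Unset Strict Implicit.
Unset Printing Implicit Defensive.

Import Order.TTheory GRing.Theory Num.Theory.
Import numFieldNormedType.Exports.

Local Open Scope classical_set_scope.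
Local Open Scope ring_scope.

(* The norm `|x| of the library on matrices is the max norm, hence the
   explicit Euclidean norm. *)
Definition l2norm (R : realType) (n : nat) (x : 'cV[R]_n) : R :=
  Num.sqrt (\sum_(i < n) x i 0 ^+ 2).

Definition spectral_norm (R : realType) (m n : nat) (A : 'M[R]_(m, n)) : R :=
  sup [set l2norm (A *m x) | x in [set x : 'cV[R]_n | l2norm x <= 1]].

(* Meaningful only for A \in unitmx, since invmx A = A otherwise. *)
Definition kappa2 (R : realType) (n : nat) (A : 'M[R]_n) : R :=
  spectral_norm A * spectral_norm (invmx A).

(* Chebyshev polynomial of the second kind of degree n, on [-1, 1]. At the
   two points x = 1 and x = -1 the quotient is 0 / 0 = 0 here instead of its
   continuous extension; this does not affect integrals. *)
Definition chebyshevU (R : realType) (n : nat) (x : R) : R :=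
  sin (n.+1%:R * acos x) / sin (acos x).

Definition rho (R : realType) (a : R) (d : nat) : R := a * pi / d%:R.

(* Ordinals start at 0: i : 'I_d stands for the index i.+1 in {1, ..., d}. *)
Definition tau (R : realType) (d : nat) (i : 'I_d) : R :=
  (i.+1%:R - 1 / 2) * pi / d%:R.

Definition seg (R : realType) (a : R) (d : nat) (i : 'I_d) : set R :=
  `[cos (tau R i + rho a d), cos (tau R i - rho a d)].

(* Column j : 'I_d stands for j.+1, whose polynomial has degree j. *)
Definition V (R : realType) (a : R) (d : nat) : 'M[R]_d :=
  \matrix_(i < d, j < d)
    (\int[@lebesgue_measure R]_(x in seg a i) chebyshevU j x)%R.

Definition is_threshold (R : realType) (b : R) : Prop :=
  0 < b < 1 /\ 2 * sin (b * pi) ^+ 2 / (b ^+ 2 * pi ^+ 2) = 1.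

(* Main.v *)
Require Import Defs.
From HB Require Import structures.
From mathcomp Require Import all_boot all_order all_algebra.
From mathcomp Require Import all_classical all_reals all_analysis.
From mathcomp Require Import ring lra zify.

Set Implicit Arguments.
Unset Strict Implicit.

Import Order.TTheory GRing.Theory Num.Theory.
Import numFieldNormedType.Exports.

Local Open Scope classical_set_scope.
Local Open Scope ring_scope.

(** V_d has orthogonal columns, so its singular values are the norms of its
    columns, and its condition number is the ratio of the largest to the
    smallest one.

    U_(j-1) has the primitive T_j / j, where T_j is the Chebyshev polynomial of
    the first kind, T_j (cos t) = cos (j t); this gives the entries
    2 sin (j tau_i) sin (j rho) / j ([V_entry]). Hence V_d is the matrix of the
    sin (j tau_i) times a diagonal matrix. The tau_i are the midpoints of a
    uniform grid of [0, pi], for which the vectors (sin (j tau_i))_i are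
    orthogonal, with squared norm d / 2 for j < d and d for j = d
    ([sum_sin_midpoints]). Writing sinc x = sin x / x, the squared singular
    values are therefore, up to a common factor, sinc (j rho)^2 for j < d and
    2 sinc (a pi)^2 for j = d ([gram_V]).

    As sinc decreases on ]0, pi[, the largest squared singular value comes from
    j = 1 or from j = d, and is max (sinc (rho)^2, 2 sinc (a pi)^2). For large d
    the smallest one comes from j = d - 1, since sinc ((d - 1) rho)^2 tends to
    sinc (a pi)^2, which is less than 2 sinc (a pi)^2. As rho tends to 0,
    sinc (rho) tends to 1. So the condition number tends to 1 / sinc (a pi) if
    2 sinc (a pi)^2 < 1 and to sqrt 2 if 2 sinc (a pi)^2 > 1, and by the
    monotonicity of sinc these two cases are a > a* and a < a*. *)

(** * Norms of matrices with orthogonal columns *)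

Lemma sqr_l2normE (R : realType) n (x : 'cV[R]_n) :
  l2norm x ^+ 2 = \sum_j x j 0 ^+ 2.
Proof. by rewrite sqr_sqrtr// sumr_ge0// => i _; exact: sqr_ge0. Qed.

Lemma sqr_l2norm (R : realType) n (x : 'cV[R]_n) :
  l2norm x ^+ 2 = (x^T *m x) 0 0.
Proof.
by rewrite sqr_l2normE mxE; apply: eq_bigr => i _; rewrite mxE expr2.
Qed.

Lemma l2norm_ge0 (R : realType) n (x : 'cV[R]_n) : 0 <= l2norm x.
Proof. exact: sqrtr_ge0. Qed.

Lemma l2normZ (R : realType) n (c : R) (x : 'cV[R]_n) :
  l2norm (c *: x) = `|c| * l2norm x.
Proof.
apply/eqP; rewrite -(@eqrXn2 _ 2)// ?mulr_ge0 ?l2norm_ge0//.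
rewrite exprMn !sqr_l2normE real_normK ?num_real// mulr_sumr.
by apply/eqP/eq_bigr => i _; rewrite mxE exprMn.
Qed.

Lemma l2norm_delta (R : realType) n (k : 'I_n) :
  l2norm (delta_mx k 0 : 'cV[R]_n) = 1.
Proof.
apply/eqP; rewrite -(@eqrXn2 _ 2)// ?l2norm_ge0// sqr_l2norm expr1n.
by rewrite trmx_delta mul_delta_mx mxE !eqxx.
Qed.

(** The supremum that defines the norm is computed by exhibiting a bound and a
    unit vector on which it is reached. *)
Lemma spectral_norm_attained (R : realType) m n (A : 'M[R]_(m, n)) (M : R)
    (x0 : 'cV[R]_n) :
  (forall x, l2norm (A *m x) <= M * l2norm x) ->
  l2norm x0 = 1 -> l2norm (A *m x0) = M -> spectral_norm A = M.
Proof.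
move=> AM x01 Ax0; have M0 : 0 <= M by rewrite -Ax0 l2norm_ge0.
pose S := [set l2norm (A *m x) | x in [set x : 'cV[R]_n | l2norm x <= 1]].
have ub : ubound S M.
  move=> _ [x /= x1 <-]; apply: (le_trans (AM x)).
  by rewrite -[leRHS]mulr1 ler_wpM2l.
have SM : S M by exists x0 => //=; rewrite x01.
apply/le_anti/andP; split; first by apply: ge_sup => //; exists M.
by apply: ub_le_sup => //; exists M.
Qed.

Section OrthogonalColumns.
Variables (R : realType) (n : nat) (A : 'M[R]_n) (lam : 'I_n -> R).
Hypothesis gramA : A^T *m A = diag_mx (\row_j lam j).
Hypothesis lam_gt0 : forall j, 0 < lam j.

Lemma orthogonal_columns_unitmx : A \in unitmx.
Proof.
have : A^T *m A \in unitmx.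
  rewrite gramA unitmxE det_diag unitfE; apply/prodf_neq0 => j _.
  by rewrite mxE gt_eqF.
by rewrite unitmx_mul => /andP[].
Qed.

Lemma sqr_l2norm_orthogonal_columns (x : 'cV[R]_n) :
  l2norm (A *m x) ^+ 2 = \sum_j lam j * x j 0 ^+ 2.
Proof.
rewrite sqr_l2norm trmx_mul mulmxA -(mulmxA x^T) gramA mul_mx_diag mxE.
by apply: eq_bigr => j _; rewrite !mxE; ring.
Qed.

Lemma l2norm_orthogonal_column k :
  l2norm (A *m delta_mx k 0) = Num.sqrt (lam k).
Proof.
apply/eqP; rewrite -(@eqrXn2 _ 2)// ?l2norm_ge0 ?sqrtr_ge0//.
rewrite sqr_l2norm_orthogonal_columns sqr_sqrtr ?ltW// (bigD1 k)//= big1.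
  by rewrite mxE !eqxx expr1n mulr1 addr0.
by move=> j /negPf jk; rewrite mxE jk expr0n mulr0.
Qed.

(** The singular values of a matrix with orthogonal columns are the norms of its
    columns. The norm of the matrix is reached on the basis vector of the
    largest column; the norm of the inverse is reached on the normalized
    smallest column. *)
Lemma kappa2_orthogonal_columns (p q : 'I_n) :
  (forall j, lam j <= lam p) -> (forall j, lam q <= lam j) ->
  kappa2 A = Num.sqrt (lam p / lam q).
Proof.
move=> lamp lamq; have Au := orthogonal_columns_unitmx.
have sq0 : 0 < Num.sqrt (lam q) by rewrite sqrtr_gt0.
have sp_ge0 := sqrtr_ge0 (lam p).
rewrite sqrtrM ?ltW// sqrtrV ?ltW// /kappa2; congr (_ * _).
  apply: (@spectral_norm_attained _ _ _ _ _ (delta_mx p 0)) => [x||].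
  - rewrite -ler_sqr ?nnegrE ?mulr_ge0 ?l2norm_ge0//.
    rewrite sqr_l2norm_orthogonal_columns exprMn.
    rewrite sqr_sqrtr ?(ltW (lam_gt0 _))// sqr_l2normE.
    by rewrite mulr_sumr; apply: ler_sum => j _; rewrite ler_wpM2r ?sqr_ge0.
  - exact: l2norm_delta.
  - exact: l2norm_orthogonal_column.
apply: (@spectral_norm_attained _ _ _ _ _
    ((Num.sqrt (lam q))^-1 *: (A *m delta_mx q 0))) => [y||].
(* With x the preimage of y, the bound reads sqrt (lam q) |x| <= |A x|. *)
- rewrite -{2}[y](mulKVmx Au) ler_pdivlMl//.
  set x := invmx A *m y.
  rewrite -ler_sqr ?nnegrE ?mulr_ge0 ?l2norm_ge0//.
  rewrite sqr_l2norm_orthogonal_columns exprMn.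
  rewrite sqr_sqrtr ?(ltW (lam_gt0 _))// sqr_l2normE.
  by rewrite mulr_sumr; apply: ler_sum => j _; rewrite ler_wpM2r ?sqr_ge0.
- rewrite l2normZ l2norm_orthogonal_column ger0_norm ?invr_ge0 ?ltW//.
  by rewrite mulVf ?gt_eqF.
- by rewrite -scalemxAr mulKmx// l2normZ l2norm_delta mulr1 ger0_norm.
Qed.

End OrthogonalColumns.

(** * The function sin x / x and the threshold *)

(** The value at 0 is 0 and not 1, hence the domain ]0, pi[ or the right limit
    at 0 in what follows. *)
Definition sinc (R : realType) (x : R) : R := sin x / x.

(** The function sin x - x cos x vanishes at 0 and has derivative x sin x. *)
Lemma mul_cos_lt_sin (R : realType) (x : R) :
  0 < x < pi -> x * cos x < sin x.
Proof.
move=> /andP[x0 xpi]; pose g := (@sin R) - (id * (@cos R)).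
have dg (y : R) : is_derive y 1 g (y * sin y).
  apply: trigger_derive; rewrite /GRing.scale/=; ring.
suff : g 0 < g x by rewrite /g !fctE sin0 mul0r subrr subr_gt0.
apply: (@gtr0_derive1_lt_cc _ g 0 pi) => //.
- move=> y; rewrite in_itv/= => /andP[y0 ypi].
  by rewrite derive1E derive_val mulr_gt0// sin_gt0_pi// y0.
- apply: derivable_within_continuous => y _; exact: ex_derive.
- by rewrite in_itv/= lexx pi_ge0.
- by rewrite in_itv/= !ltW.
Qed.

Lemma sinc_gt0 (R : realType) (x : R) : 0 < x < pi -> 0 < sinc x.
Proof. by move=> xI; rewrite divr_gt0 ?sin_gt0_pi//; case/andP: xI. Qed.

Lemma cos_le_sinc (R : realType) (x : R) : 0 < x < pi -> cos x <= sinc x.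
Proof.
move=> xI; have /andP[x0 _] := xI.
by rewrite ler_pdivlMr// mulrC ltW// mul_cos_lt_sin.
Qed.

(** The derivative (x cos x - sin x) / x^2 is negative by [mul_cos_lt_sin]. *)
Lemma sinc_lt_homo (R : realType) :
  {in `]0, pi[%R &, {homo @sinc R : x y /~ x < y}}.
Proof.
have ds (x : R) : x != 0 ->
    is_derive x 1 (@sinc R) ((x * cos x - sin x) / x ^+ 2).
  move=> x0.
  have dV : is_derive x (1 : R) (fun y : R => y^-1) (- x ^- 2 *: 1).
    exact: is_deriveV.
  have -> : @sinc R = @sin R * (fun y => y^-1) by apply/funext => y.
  by apply: trigger_derive; rewrite /GRing.scale/=; field.
apply: (@ltr0_derive1_lt_oo _ (@sinc R) 0 pi) => x;
  rewrite ?inE/= ?in_itv/= => xI; have /andP[x0 xpi] : 0 < x < pi by [].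
- by have [] := ds x (lt0r_neq0 x0).
- have [? dsx] := ds x (lt0r_neq0 x0).
  rewrite derive1E dsx pmulr_llt0 ?invr_gt0 ?exprn_gt0//.
  by rewrite subr_lt0 mul_cos_lt_sin// x0.
- have [dx _] := ds x (lt0r_neq0 x0).
  by apply: differentiable_continuous; apply/derivable1_diffP.
Qed.

Lemma sinc_le1 (R : realType) (x : R) : 0 < x -> sinc x <= 1.
Proof.
move=> x0; rewrite ler_pdivrMr// mul1r.
have [c _] : exists2 c : R, c \in `]0, x[%R & sin x - sin 0 = cos c * (x - 0).
  apply: MVT => //.
  by apply: continuous_subspaceT => ?; exact: continuous_sin.
by rewrite sin0 !subr0 => ->; rewrite ger_pMl// cos_le1.
Qed.

Lemma continuous_sinc (R : realType) (x : R) :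
  x != 0 -> {for x, continuous (@sinc R)}.
Proof.
move=> x0; apply: cvgM; first exact: continuous_sin.
by apply: cvgV => //; exact: cvg_id.
Qed.

Lemma thresholdE (R : realType) (b : R) : 0 < b ->
  2 * sin (b * pi) ^+ 2 / (b ^+ 2 * pi ^+ 2) = 2 * sinc (b * pi) ^+ 2.
Proof.
move=> b0; rewrite /sinc; move: pi (pi_gt0 R) => p p0; field.
by rewrite (lt0r_neq0 b0) (lt0r_neq0 p0).
Qed.

Lemma sqr_sinc_mul_pi_lt (R : realType) (x y : R) : 0 < x -> x < y -> y < 1 ->
  2 * sinc (y * pi) ^+ 2 < 2 * sinc (x * pi) ^+ 2.
Proof.
move=> x0 xy y1; have pi0 := pi_gt0 R.
have y0 := lt_trans x0 xy.
have xI : 0 < x * pi < pi by rewrite mulr_gt0//= gtr_pMl// (lt_trans xy).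
have yI : 0 < y * pi < pi by rewrite mulr_gt0//= gtr_pMl.
have sx := sinc_gt0 xI; have sy := sinc_gt0 yI.
rewrite ltr_pM2l// ltr_sqr ?nnegrE ?(ltW sx) ?(ltW sy)//.
by apply: sinc_lt_homo; rewrite ?in_itv// ltr_pM2r.
Qed.

(** Existence is the intermediate value theorem between b = 1/4, where the
    quotient is 16 / pi^2 > 1, and b = 1, where it vanishes; uniqueness is
    strict monotonicity. *)
Lemma exists_unique_threshold (R : realType) :
  exists! b : R, is_threshold b.
Proof.
have pi0 := pi_gt0 R.
pose f (b : R) := 2 * sin (b * pi) ^+ 2 / (b ^+ 2 * pi ^+ 2).
have fc : {within `[4^-1, 1], continuous f}.
  apply: derivable_within_continuous => y; rewrite in_itv/= => /andP[y4 _].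
  have y0 : 0 < y by lra.
  have ? : y ^+ 2 * pi ^+ 2 != 0 by rewrite mulf_neq0// expf_neq0// gt_eqF.
  rewrite /f; apply: derivableM; last first.
    by apply: derivableV => //; apply: ex_derive.
  have -> : (fun b : R => 2 * sin (b * pi) ^+ 2) =
     (fun b : R => 2 * (sin \o (fun b => b * pi)) b ^+ 2) by [].
  exact: ex_derive.
have f1 : f 1 = 0 by rewrite /f mul1r sinpi expr0n/= mulr0 mul0r.
have sq : sin (4^-1 * pi) ^+ 2 = 2^-1 :> R.
  rewrite sin2cos2; have := cos_mulr2n (4^-1 * pi : R).
  have -> : (4^-1 * pi) *+ 2 = pi / 2 :> R by rewrite mulr2n; field.
  by rewrite cos_pihalf; lra.
have f4 : 1 <= f 4^-1.
  rewrite /f sq mulfV// mul1r invf_ge1; last by rewrite mulr_gt0// exprn_gt0.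
  rewrite -exprMn exprn_ile1//; first by rewrite mulr_ge0// ltW.
  have := pihalf_lt2 R; lra.
have [b] : exists2 b, b \in `[4^-1, 1]%R & f b = 1.
  apply: IVT => //; first lra.
  by rewrite f1 min_r ?max_l; lra.
rewrite in_itv/= => /andP[b4 b1] fb; have b0 : 0 < b by lra.
have bI : 0 < b < 1.
  rewrite b0 lt_neqAle b1 andbT; apply/eqP => b1E.
  by move: fb; rewrite b1E f1 => /eqP; rewrite eq_sym oner_eq0.
have inj (x y : R) : is_threshold x -> is_threshold y -> x < y -> False.
  move=> [/andP[x0 x1] fx] [/andP[y0 y1] fy] xy.
  have := sqr_sinc_mul_pi_lt x0 xy y1.
  by rewrite -!thresholdE// fx fy ltxx.
exists b; split => // c ct; have [bc|cb|//] := ltgtP b c.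
- by case: (inj b c).
- by case: (inj c b).
Qed.

(** * The half-width rho *)

Lemma rho_mul_in (R : realType) (a : R) d k : 0 < a < 1 -> (0 < k <= d)%N ->
  0 < k%:R * rho a d < pi.
Proof.
move=> /andP[a0 a1] /andP[k0 kd]; have pi0 := pi_gt0 R.
have dR : 0 < d%:R :> R by rewrite ltr0n (leq_trans k0).
have kR : 0 < k%:R :> R by rewrite ltr0n.
rewrite /rho; apply/andP; split; first by rewrite !(mulr_gt0, invr_gt0).
rewrite mulrA ltr_pdivrMr//.
have kdR : k%:R <= d%:R :> R by rewrite ler_nat.
rewrite mulrA mulrC ltr_pM2l//.
by rewrite (lt_le_trans _ kdR)// gtr_pMr.
Qed.

Lemma rho_in (R : realType) (a : R) d : 0 < a < 1 -> (0 < d)%N ->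
  0 < rho a d < pi.
Proof. by move=> aI d0; have := @rho_mul_in R a d 1 aI d0; rewrite mul1r. Qed.

Lemma mul_pred_rho (R : realType) (a : R) d :
  d.+1%:R * rho a d.+2 = a * pi - rho a d.+2.
Proof.
have -> : d.+1%:R = d.+2%:R - 1 :> R by rewrite -[in RHS]natr1 addrK.
by rewrite mulrBl mul1r /rho [_%:R * _]mulrC divfK ?pnatr_eq0.
Qed.

Lemma mul_rho (R : realType) (a : R) d : d.+1%:R * rho a d.+1 = a * pi.
Proof. by rewrite /rho mulrC divfK ?pnatr_eq0. Qed.

Lemma cvg_rho (R : realType) (a : R) : rho a d @[d --> \oo] --> (0 : R).
Proof.
rewrite -[X in _ --> X](mulr0 (a * pi)); apply: cvgMl_tmp.
apply/(@gtr0_cvgV0 R nat _ _ (fun d => d%:R)); last exact: cvgr_idn.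
by near=> d; rewrite ltr0n; near: d; exact: nbhs_infty_gt.
Unshelve. all: by end_near. Qed.

(** Squeezed between cos rho and 1. *)
Lemma cvg_sinc_rho (R : realType) (a : R) : 0 < a < 1 ->
  sinc (rho a d) @[d --> \oo] --> (1 : R).
Proof.
move=> aI.
apply: (@squeeze_cvgr _ _ _ _ (fun d => cos (rho a d)) (cst 1)).
- near=> d.
  have rI : 0 < rho a d < pi.
    by rewrite rho_in//; near: d; exact: nbhs_infty_ge.
  rewrite cos_le_sinc//= sinc_le1//.
  by case/andP: rI.
- rewrite -[X in _ --> X]cos0.
  by apply: (cvg_comp _ _ (cvg_rho a)); exact: continuous_cos.
- exact: cvg_cst.
Unshelve. all: by end_near. Qed.

Lemma cvg_sinc_pred (R : realType) (a : R) : 0 < a < 1 ->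
  sinc (a * pi - rho a d) @[d --> \oo] --> sinc (a * pi).
Proof.
move=> /andP[a0 _].
have h : a * pi - rho a d @[d --> \oo] --> a * pi.
  rewrite -[X in _ --> X]subr0; apply: cvgB; [exact: cvg_cst|exact: cvg_rho].
apply: (cvg_comp _ _ h).
by apply: continuous_sinc; rewrite mulf_neq0 ?gt_eqF ?pi_gt0.
Qed.

(** * Integrals of Chebyshev polynomials *)

(** The three-term recurrence T_(n+2) = 2 X T_(n+1) - T_n, with two consecutive
    polynomials carried through the induction. *)
Lemma chebyshevT_exists (R : realType) n :
  {p : {poly R} | forall x, p.[cos x] = cos (n%:R * x)}.
Proof.
suff [p [q [hp _]]] : {p : {poly R} & {q : {poly R} |
   (forall x, p.[cos x] = cos (n%:R * x)) /\
   (forall x, q.[cos x] = cos (n.+1%:R * x))}} by exists p.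
elim: n => [|n [p [q [hp hq]]]].
  by exists 1, 'X; split=> x; rewrite ?hornerE ?mul0r ?cos0 ?mul1r.
exists q, ('X *+ 2 * q - p); split=> // x; rewrite !hornerE hp hq.
have -> : n.+2%:R * x = n.+1%:R * x + x by rewrite -[n.+2]addn1 natrD; ring.
have -> : n%:R * x = n.+1%:R * x - x by rewrite -[n.+1]addn1 natrD; ring.
by rewrite cosB cosD; ring.
Qed.

Definition chebyshevT (R : realType) n : {poly R} :=
  sval (chebyshevT_exists R n).

Lemma chebyshevT_cos (R : realType) n (x : R) :
  (chebyshevT R n).[cos x] = cos (n%:R * x).
Proof. exact: (svalP (chebyshevT_exists R n)). Qed.

(** Both sides are, up to sign, the derivative of cos (n x), computed through
    the polynomial and directly. *)
Lemma deriv_chebyshevT_cos (R : realType) n (x : R) :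
  (chebyshevT R n)^`().[cos x] * sin x = n%:R * sin (n%:R * x).
Proof.
set p := chebyshevT R n.
have d1 : is_derive x (1 : R) (horner p \o cos) (p^`().[cos x] * - sin x).
  apply: trigger_derive; rewrite /GRing.scale/=; ring.
have d2 : is_derive x (1 : R) (cos \o (fun y => n%:R * y))
    (- sin (n%:R * x) * n%:R).
  apply: trigger_derive; rewrite /GRing.scale/=; ring.
have E : horner p \o cos = cos \o (fun y => n%:R * y).
  by apply/funext => y /=; rewrite chebyshevT_cos.
move: d1; rewrite E => d1.
have := @derive_val _ _ _ _ _ _ _ d1; rewrite (@derive_val _ _ _ _ _ _ _ d2).
by lra.
Qed.

(** A polynomial primitive of U_n on the open interval. Having a polynomial
    removes all regularity questions at the endpoints -1 and 1, where acos is
    not differentiable and which a segment s_i can touch. *)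
Lemma chebyshevUE (R : realType) n (x : R) : -1 < x < 1 ->
  chebyshevU n x = (n.+1%:R^-1 *: chebyshevT R n.+1)^`().[x].
Proof.
move=> /andP[xN1 x1].
have xI : -1 <= x <= 1 by rewrite !ltW.
have s0 : 0 < sin (acos x).
  by rewrite sin_gt0_pi// acos_gt0 ?acos_ltpi ?xN1 ?x1 ?ltW.
have := deriv_chebyshevT_cos n.+1 (acos x).
rewrite acosK// => h.
rewrite /chebyshevU derivZ hornerZ; apply: (mulIf (lt0r_neq0 s0)).
by rewrite mulfVK ?gt_eqF// -mulrA h mulKf// pnatr_eq0.
Qed.

Lemma integral_chebyshevU (R : realType) n (u v : R) : cos u <= cos v ->
  (\int[@lebesgue_measure R]_(x in `[cos u, cos v]) chebyshevU n x)%R =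
  (cos (n.+1%:R * v) - cos (n.+1%:R * u)) / n.+1%:R.
Proof.
rewrite le_eqVlt => /orP[/eqP uv|uv].
  by rewrite -!chebyshevT_cos uv subrr mul0r set_itv1 Rintegral_set1.
pose P := n.+1%:R^-1 *: chebyshevT R n.+1.
have mP : measurable_fun `]cos u, cos v[ (horner P^`()).
  apply: measurable_funTS; apply: measurable_realfun.continuous_measurable_fun.
  exact: continuous_horner.
have UP : {in `]cos u, cos v[, @chebyshevU R n =1 horner P^`()}.
  move=> x; rewrite ?inE/= ?in_itv/= => /andP[ux xv]; apply: chebyshevUE.
  by rewrite (le_lt_trans (cos_geN1 u) ux) (lt_le_trans xv (cos_le1 v)).
rewrite /Rintegral.
rewrite (@eq_integral_itv_bounded _ _ _ (horner P^`()))//; last first.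
  apply: eq_measurable_fun mP => x xI; apply/esym/UP.
  by move: xI; rewrite inE.
rewrite (@continuous_FTC2 _ (horner P^`()) (horner P))//.
- by rewrite -EFinB/= /P !hornerZ !chebyshevT_cos; ring.
- by apply: continuous_subspaceT => ?; exact: continuous_horner.
- split=> [x _||]; first exact: derivable_horner.
  + by apply: cvg_at_right_filter; exact: continuous_horner.
  + by apply: cvg_at_left_filter; exact: continuous_horner.
- by move=> x _; rewrite derivE.
Qed.

(** The primitive is even in the angle, so the formula also holds when
    tau_i - rho is negative or tau_i + rho exceeds pi. *)
Lemma V_entry (R : realType) (a : R) d (i j : 'I_d) : 0 < a < 1 ->
  V a d i j = 2 / j.+1%:R * sin (j.+1%:R * tau R i) * sin (j.+1%:R * rho a d).
Proof.
move=> aI; have d0 : 0 < d%:R :> R.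
  by rewrite ltr0n (leq_ltn_trans _ (ltn_ord i)).
have pi0 := pi_gt0 R.
have rhoI : 0 < rho a d < pi by rewrite rho_in ?aI// -(ltr0n R).
have tauI : 0 < tau R i < pi.
  rewrite /tau; apply/andP; split.
    rewrite divr_gt0// mulr_gt0//.
    have : 1 <= i.+1%:R :> R by rewrite ler1n.
    lra.
  rewrite ltr_pdivrMr// mulrC ltr_pM2l//.
  have : i.+1%:R <= d%:R :> R by rewrite ler_nat.
  lra.
rewrite mxE /seg integral_chebyshevU.
  have : j.+1%:R != 0 :> R by rewrite pnatr_eq0.
  move: j.+1%:R => k k0; rewrite mulrBr mulrDr cosB cosD.
  by move: (k * tau R i) (k * rho a d) => s t; field.
rewrite cosB cosD.
have : 0 < sin (tau R i) * sin (rho a d) by rewrite mulr_gt0// sin_gt0_pi.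
lra.
Qed.

(** * Orthogonality of the columns *)

Lemma sin_natmul_pi (R : realType) n : sin (n%:R * pi) = 0 :> R.
Proof.
by rewrite mulr_natl -[_ *+ n]add0r (alternatingn (@sinDpi R)) sin0 mulr0.
Qed.

Lemma cos_natmul_pi (R : realType) n : cos (n%:R * pi) = (-1) ^+ n :> R.
Proof.
by rewrite mulr_natl -[_ *+ n]add0r (alternatingn (@cosDpi R)) cos0 mulr1.
Qed.

(** Multiplied by 2 sin (m pi / 2d), the sum telescopes to sin (m pi) = 0. *)
Lemma sum_cos_midpoints (R : realType) d m : (0 < m < d.*2)%N ->
  \sum_(i < d) cos (m%:R * tau R i) = 0.
Proof.
move=> /andP[m0 md].
have d0 : (0 < d)%N by rewrite -double_gt0 (leq_ltn_trans _ md).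
have dR : d%:R != 0 :> R by rewrite pnatr_eq0 -lt0n.
pose t : R := m%:R * pi / d%:R.
have st : 0 < sin (t / 2).
  rewrite sin_gt0_pi// /t !(divr_gt0, mulr_gt0) ?ltr0n ?pi_gt0//=.
  rewrite -mulrA -invfM ltr_pdivrMr ?mulr_gt0 ?ltr0n// mulrC ltr_pM2l ?pi_gt0//.
  by rewrite -natrM ltr_nat muln2.
have s2 : 2 * sin (t / 2) != 0 by rewrite mulf_neq0// gt_eqF.
apply: (mulfI s2); rewrite mulr0 mulr_sumr.
have E (i : nat) :
    2 * sin (t / 2) * cos (m%:R * ((i.+1%:R - 1 / 2) * pi / d%:R))
     = sin (i.+1%:R * t) - sin (i%:R * t).
  have -> : i.+1%:R * t = m%:R * ((i.+1%:R - 1 / 2) * pi / d%:R) + t / 2.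
    by rewrite /t; field.
  have -> : i%:R * t = m%:R * ((i.+1%:R - 1 / 2) * pi / d%:R) - t / 2.
    by rewrite /t -[i.+1]addn1 natrD; field.
  by rewrite sinD sinB; ring.
under eq_bigr => i _ do rewrite E.
rewrite -(big_mkord xpredT (fun i => sin (i.+1%:R * t) - sin (i%:R * t))).
rewrite telescope_sumr// mul0r sin0 subr0 /t.
have -> : d%:R * (m%:R * pi / d%:R) = m%:R * pi :> R by field.
exact: sin_natmul_pi.
Qed.

Lemma sum_cos_midpoints_double (R : realType) d :
  \sum_(i < d) cos (d.*2%:R * tau R i) = - d%:R.
Proof.
rewrite -mulNrn -[in RHS](card_ord d) -sumr_const; apply: eq_bigr => i _.
have d0 : d%:R != 0 :> R.
  by rewrite pnatr_eq0 -lt0n (leq_ltn_trans _ (ltn_ord i)).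
have -> : d.*2%:R * tau R i = i.*2.+1%:R * pi.
  by rewrite /tau -!addnn -[(i + i).+1]addn1 -[i.+1]addn1 !natrD; field.
by rewrite cos_natmul_pi exprS -mul2n exprM sqrrN !expr1n mulr1.
Qed.

(** Orthogonality of the discrete sine transform at midpoints. The last vector
    is longer by a factor sqrt 2: its entries are sin ((i - 1/2) pi) = 1 or -1,
    so the cosine of the doubled angle sums to - d and not to 0. *)
Lemma sum_sin_midpoints (R : realType) d (j k : 'I_d) :
  \sum_(i < d) sin (j.+1%:R * tau R i) * sin (k.+1%:R * tau R i) =
  (j == k)%:R * (d%:R / 2 * (1 + (j.+1 == d)%:R)).
Proof.
wlog jk : j k / (j <= k)%N.
  move=> H; have [/H//|/ltnW/H E] := leqP j k.
  under eq_bigr do rewrite mulrC.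
  by rewrite E eq_sym; case: eqVneq => [->//|]; rewrite !mul0r.
have E (i : 'I_d) : sin (j.+1%:R * tau R i) * sin (k.+1%:R * tau R i) =
    (cos ((k - j)%N%:R * tau R i) - cos ((j.+1 + k.+1)%N%:R * tau R i)) / 2.
  have -> : (k - j)%N%:R * tau R i = k.+1%:R * tau R i - j.+1%:R * tau R i.
    by rewrite natrB// -[j.+1]addn1 -[k.+1]addn1 !natrD; ring.
  have -> : (j.+1 + k.+1)%N%:R * tau R i =
      k.+1%:R * tau R i + j.+1%:R * tau R i.
    by rewrite natrD mulrDl addrC.
  by rewrite cosB cosD; field.
under eq_bigr => i _ do rewrite E.
rewrite -mulr_suml sumrB.
have [<-|njk] := eqVneq j k.
  rewrite subnn; under eq_bigr do rewrite mul0r cos0.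
  rewrite sumr_const card_ord addnn.
  have [jd|nd] := eqVneq j.+1 d.
    by rewrite jd sum_cos_midpoints_double !mulr1n; field.
  rewrite sum_cos_midpoints; last first.
    by rewrite double_gt0/= ltn_double ltn_neqAle nd ltn_ord.
  by rewrite mulr1n mulr0n; field.
have ltjk : (j < k)%N by rewrite ltn_neqAle njk.
have ltkd := ltn_ord k.
by rewrite !sum_cos_midpoints ?subrr ?mul0r//; lia.
Qed.

(** The squared norm of column [j.+1] of V_d. The factor before the parentheses
    is common to all columns and cancels in the condition number; in the
    parentheses, the sinc decreases with the column and the last column gets an
    additional factor 2. *)
Definition sqr_sv (R : realType) (a : R) (d : nat) (j : nat) : R :=
  2 * d%:R * rho a d ^+ 2 *
  ((1 + (j.+1 == d)%:R) * sinc (j.+1%:R * rho a d) ^+ 2).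

Lemma gram_V (R : realType) (a : R) d : 0 < a < 1 ->
  (V a d)^T *m V a d = diag_mx (\row_j sqr_sv a d j).
Proof.
move=> aI; apply/matrixP => j k; rewrite !mxE.
pose c (j : 'I_d) : R := 2 / j.+1%:R * sin (j.+1%:R * rho a d).
under eq_bigr => i _.
  rewrite mxE !V_entry//.
  have -> : 2 / j.+1%:R * sin (j.+1%:R * tau R i) * sin (j.+1%:R * rho a d) *
    (2 / k.+1%:R * sin (k.+1%:R * tau R i) * sin (k.+1%:R * rho a d)) =
    c j * c k * (sin (j.+1%:R * tau R i) * sin (k.+1%:R * tau R i)).
    by rewrite /c; ring.
  over.
rewrite -mulr_sumr sum_sin_midpoints.
have [<-|] := eqVneq j k; last by rewrite mul0r mulr0 mulr0n.
have d0 : (0 < d)%N by rewrite (leq_ltn_trans _ (ltn_ord j)).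
have rho0 : rho a d != 0.
  by have /andP[/lt0r_neq0] := rho_in aI d0.
rewrite !mulr1n mul1r /c /sqr_sv /sinc.
have : j.+1%:R != 0 :> R by rewrite pnatr_eq0.
by move: j.+1%:R (_ == d)%:R => x y x0; field; rewrite rho0.
Qed.

Lemma sqr_sv_scale_gt0 (R : realType) (a : R) d : 0 < a < 1 -> (0 < d)%N ->
  0 < 2 * d%:R * rho a d ^+ 2.
Proof.
move=> aI d0; have /andP[r0 _] := rho_in aI d0.
by apply: mulr_gt0; [apply: mulr_gt0; rewrite ?ltr0n|exact: exprn_gt0].
Qed.

Lemma sqr_sv_gt0 (R : realType) (a : R) d (j : 'I_d) :
  0 < a < 1 -> 0 < sqr_sv a d j.
Proof.
move=> aI; have d0 : (0 < d)%N by rewrite (leq_ltn_trans _ (ltn_ord j)).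
have s0 : 0 < sinc (j.+1%:R * rho a d) by rewrite sinc_gt0// rho_mul_in/=.
apply: mulr_gt0; first exact: sqr_sv_scale_gt0.
by apply: mulr_gt0; [rewrite ltr_pwDl|exact: exprn_gt0].
Qed.

Lemma V_unitmx (R : realType) (a : R) d : 0 < a < 1 -> V a d \in unitmx.
Proof.
move=> aI; apply: (orthogonal_columns_unitmx (gram_V d aI)) => j.
exact: sqr_sv_gt0.
Qed.

Lemma kappa2_V (R : realType) (a : R) d (p q : 'I_d) : 0 < a < 1 ->
  (forall j : 'I_d, sqr_sv a d j <= sqr_sv a d p) ->
  (forall j : 'I_d, sqr_sv a d q <= sqr_sv a d j) ->
  kappa2 (V a d) = Num.sqrt (1 + (p.+1 == d)%:R) * sinc (p.+1%:R * rho a d) /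
    (Num.sqrt (1 + (q.+1 == d)%:R) * sinc (q.+1%:R * rho a d)).
Proof.
move=> aI maxp minq.
rewrite (kappa2_orthogonal_columns (gram_V d aI) _ maxp minq); last first.
  by move=> j; exact: sqr_sv_gt0.
have d0 : (0 < d)%N by rewrite (leq_ltn_trans _ (ltn_ord p)).
have c0 := sqr_sv_scale_gt0 aI d0.
have nneg (j : 'I_d) :
    0 <= (1 + (j.+1 == d)%:R) * sinc (j.+1%:R * rho a d) ^+ 2.
  by apply: mulr_ge0; [exact: addr_ge0|exact: sqr_ge0].
have sq (j : 'I_d) :
    Num.sqrt ((1 + (j.+1 == d)%:R) * sinc (j.+1%:R * rho a d) ^+ 2) =
    Num.sqrt (1 + (j.+1 == d)%:R) * sinc (j.+1%:R * rho a d).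
  rewrite sqrtrM ?addr_ge0// sqrtr_sqr ger0_norm// ltW// sinc_gt0//.
  by rewrite rho_mul_in/=.
rewrite /sqr_sv -mulf_div (mulfV (lt0r_neq0 c0)) mul1r sqrtrM; last first.
  exact: nneg.
by rewrite sqrtrV; [rewrite !sq|exact: nneg].
Qed.

(** * Extreme singular values and limits *)

Lemma sqr_sv_le (R : realType) (a : R) d (i j : nat) : 0 < a < 1 -> (0 < d)%N ->
  (1 + (i.+1 == d)%:R) * sinc (i.+1%:R * rho a d) ^+ 2 <=
    (1 + (j.+1 == d)%:R) * sinc (j.+1%:R * rho a d) ^+ 2 ->
  sqr_sv a d i <= sqr_sv a d j.
Proof. by move=> aI d0; rewrite ler_pM2l// sqr_sv_scale_gt0. Qed.

Lemma sqr_sinc_rho_le (R : realType) (a : R) d i j : 0 < a < 1 ->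
  (i <= j < d)%N ->
  sinc (j.+1%:R * rho a d) ^+ 2 <= sinc (i.+1%:R * rho a d) ^+ 2.
Proof.
move=> aI /andP[ij jd]; have id := leq_ltn_trans ij jd.
have jI : 0 < j.+1%:R * rho a d < pi by exact: rho_mul_in.
have iI : 0 < i.+1%:R * rho a d < pi by exact: rho_mul_in.
have sj := sinc_gt0 jI; have si := sinc_gt0 iI.
rewrite ler_sqr ?nnegrE ?(ltW sj) ?(ltW si)//.
move: ij; rewrite leq_eqVlt => /orP[/eqP->//|ij].
apply/ltW/sinc_lt_homo; rewrite ?in_itv//=.
have /andP[r0 _] : 0 < rho a d < pi by rewrite rho_in// (leq_ltn_trans _ jd).
by rewrite ltr_pM2r// ltr_nat.
Qed.

(** Only three columns can be extreme: the first one and the last one for the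
    maximum, the penultimate one for the minimum. The dimension is written
    [n.+2], so that there is a penultimate column. *)
Section Extremes.
Variables (R : realType) (a : R) (n : nat).
Hypothesis aI : 0 < a < 1.
Hypothesis penultimate_le :
  sinc (a * pi - rho a n.+2) ^+ 2 <= 2 * sinc (a * pi) ^+ 2.

Let penultimate : 'I_n.+2 := Ordinal (leqnSn n.+1).

Let neq_last : (n.+1 == n.+2) = false.
Proof. by rewrite ltn_eqF. Qed.

Lemma penultimate_min (j : 'I_n.+2) :
  sqr_sv a n.+2 penultimate <= sqr_sv a n.+2 j.
Proof.
apply: sqr_sv_le => //=; rewrite neq_last addr0 mul1r.
have [->|jn] := eqVneq j.+1 n.+2; first by rewrite mul_pred_rho mul_rho.
rewrite addr0 mul1r sqr_sinc_rho_le//; have := ltn_ord j; lia.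
Qed.

Lemma kappa2_V_first : 2 * sinc (a * pi) ^+ 2 <= sinc (rho a n.+2) ^+ 2 ->
  kappa2 (V a n.+2) = sinc (rho a n.+2) / sinc (a * pi - rho a n.+2).
Proof.
move=> first_ge.
rewrite (@kappa2_V _ _ _ ord0 penultimate)//=.
- by rewrite neq_last addr0 sqrtr1 !mul1r mul_pred_rho.
- move=> j; apply: sqr_sv_le => //=; rewrite addr0 mul1r.
  have [->|jn] := eqVneq j.+1 n.+2; first by rewrite mul1r mul_rho.
  by rewrite addr0 mul1r sqr_sinc_rho_le/=.
- exact: penultimate_min.
Qed.

Lemma kappa2_V_last : sinc (rho a n.+2) ^+ 2 <= 2 * sinc (a * pi) ^+ 2 ->
  kappa2 (V a n.+2) =
  Num.sqrt 2 * sinc (a * pi) / sinc (a * pi - rho a n.+2).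
Proof.
move=> last_ge.
rewrite (@kappa2_V _ _ _ ord_max penultimate)//=.
- by rewrite neq_last eqxx addr0 sqrtr1 mul1r mul_pred_rho mul_rho.
- move=> j; apply: sqr_sv_le => //=; rewrite eqxx mul_rho.
  have [->|jn] := eqVneq j.+1 n.+2; first by rewrite mul_rho.
  rewrite addr0 mul1r (le_trans _ last_ge)//.
  by have := @sqr_sinc_rho_le _ a n.+2 0 j aI (ltn_ord j); rewrite mul1r.
- exact: penultimate_min.
Qed.

End Extremes.

(** The limits of the two sides are s^2 and 2 s^2, for s = sinc (a pi) > 0. *)
Lemma penultimate_near (R : realType) (a : R) : 0 < a < 1 ->
  \forall d \near \oo,
    sinc (a * pi - rho a d) ^+ 2 <= 2 * sinc (a * pi) ^+ 2.
Proof.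
move=> aI; have /andP[a0 a1] := aI; have pi0 := pi_gt0 R.
have s0 : 0 < sinc (a * pi) by rewrite sinc_gt0// mulr_gt0//= gtr_pMl.
have h : sinc (a * pi - rho a d) ^+ 2 @[d --> \oo] --> sinc (a * pi) ^+ 2.
  rewrite expr2; under eq_fun do rewrite expr2.
  by apply: cvgM; exact: cvg_sinc_pred.
apply: (cvgr_le _ h); have : 0 < sinc (a * pi) ^+ 2 by rewrite exprn_gt0.
lra.
Qed.

(** For large d the last column is shorter than the first one, so the ratio of
    the extreme singular values is that of sinc at rho and at a pi - rho. *)
Lemma cvg_kappa2_V_first (R : realType) (a : R) : 0 < a < 1 ->
  2 * sinc (a * pi) ^+ 2 < 1 ->
  kappa2 (V a d) @[d --> \oo] --> a * pi / sin (a * pi).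
Proof.
move=> aI lt1; have /andP[a0 a1] := aI; have pi0 := pi_gt0 R.
have s0 : 0 < sinc (a * pi) by rewrite sinc_gt0// mulr_gt0//= gtr_pMl.
have h : sinc (rho a d) ^+ 2 @[d --> \oo] --> (1 : R).
  rewrite -[X in _ --> X](mulr1 1); under eq_fun do rewrite expr2.
  by apply: cvgM; exact: cvg_sinc_rho.
have lim : sinc (rho a d) / sinc (a * pi - rho a d) @[d --> \oo] -->
    a * pi / sin (a * pi).
  rewrite -[X in _ --> X]invf_div -[X in _ --> X]mul1r.
  apply: cvgM; first exact: cvg_sinc_rho.
  by apply: cvgV; [exact: lt0r_neq0|exact: cvg_sinc_pred].
apply: cvg_trans lim; apply: near_eq_cvg; near=> d.
have d2 : (1 < d)%N by near: d; exact: nbhs_infty_gt.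
have pen : sinc (a * pi - rho a d) ^+ 2 <= 2 * sinc (a * pi) ^+ 2.
  by near: d; exact: penultimate_near.
have fst : 2 * sinc (a * pi) ^+ 2 <= sinc (rho a d) ^+ 2.
  by near: d; exact: (cvgr_ge _ h).
(* [d] itself cannot be destructed, as it is bound by [near]. *)
by move: (d) d2 pen fst => [|[|n]]// _ pen fst; rewrite kappa2_V_first.
Unshelve. all: by end_near. Qed.

(** The last column stays the longest, and its factor sqrt 2 is all that remains
    in the limit, where the sinc of the last two columns agree. *)
Lemma cvg_kappa2_V_last (R : realType) (a : R) : 0 < a < 1 ->
  1 < 2 * sinc (a * pi) ^+ 2 ->
  kappa2 (V a d) @[d --> \oo] --> (Num.sqrt 2 : R).
Proof.
move=> aI gt1; have /andP[a0 a1] := aI; have pi0 := pi_gt0 R.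
have s0 : 0 < sinc (a * pi) by rewrite sinc_gt0// mulr_gt0//= gtr_pMl.
have lim : Num.sqrt 2 * sinc (a * pi) / sinc (a * pi - rho a d)
    @[d --> \oo] --> (Num.sqrt 2 : R).
  rewrite -[X in _ --> X](mulfK (lt0r_neq0 s0)).
  apply: cvgMl_tmp.
  by apply: cvgV; [exact: lt0r_neq0|exact: cvg_sinc_pred].
apply: cvg_trans lim; apply: near_eq_cvg; near=> d.
have d2 : (1 < d)%N by near: d; exact: nbhs_infty_gt.
have pen : sinc (a * pi - rho a d) ^+ 2 <= 2 * sinc (a * pi) ^+ 2.
  by near: d; exact: penultimate_near.
move: (d) d2 pen => [|[|n]]// _ pen; rewrite kappa2_V_last//.
have rI := @rho_in _ a n.+2 aI isT; have /andP[r0 _] := rI.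
by rewrite (le_trans _ (ltW gt1))// expr_le1// ?sinc_le1// ltW// sinc_gt0.
Unshelve. all: by end_near. Qed.

Theorem theorem3p13 (R : realType) :
  (exists! astar : R, is_threshold astar) /\
  forall astar a : R, is_threshold astar -> 0 < a < 1 ->
    [/\ forall (d : nat) (i j : 'I_d),
          V a d i j =
            2 / j.+1%:R * sin (j.+1%:R * tau R i) * sin (j.+1%:R * rho a d),
        forall d : nat, (0 < d)%N -> V a d \in unitmx,
        astar < a ->
          kappa2 (V a d) @[d --> \oo] --> a * pi / sin (a * pi)
      & a < astar ->
          kappa2 (V a d) @[d --> \oo] --> (Num.sqrt 2 : R)].
Proof.
split; first exact: exists_unique_threshold.
move=> b a [/andP[b0 b1]]; rewrite thresholdE// => thr aI.
have /andP[a0 a1] := aI; split.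
- by move=> d i j; exact: V_entry.
- by move=> d _; exact: V_unitmx.
- move=> ba; apply: cvg_kappa2_V_first => //.
  by have := sqr_sinc_mul_pi_lt b0 ba a1; rewrite thr.
- move=> ab; apply: cvg_kappa2_V_last => //.
  by have := sqr_sinc_mul_pi_lt a0 ab b1; rewrite thr.
Qed.
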